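(* Let $X$ be a topological space. The following statements are equivalent: (1) $X$ is $e^*\theta$-normal; (2) for every pair of open sets $U$ and $V$ with $U\cup V=X$, there exist $e^*$-$\theta$-closed sets $A$ and $B$ such that $A\subseteq U$, $B\subseteq V$ and $A\cup B=X$; (3) for each closed set $F$ and every open set $G$ containing $F$, there exists an $e^*$-$\theta$-open set $U$ of $X$ such that $F\subseteq U\subseteq e^*\text{-}cl_\theta(U)\subseteq G$.
   Context: For a subset $A$ of a topological space $X$, $cl(A)$ and $int(A)$ denote closure and interior. The $\delta$-closure $cl_\delta(A)$ is the set of points $x\in X$ such that $int(cl(U))\cap A\neq\emptyset$ for every open $U$ containing $x$. $A$ is $e^*$-open if $A\subseteq cl(int(cl_\delta(A)))$; complements of $e^*$-open sets are $e^*$-closed; $e^*\text{-}cl(A)$ is the intersection of all $e^*$-closed sets containing $A$. The $e^*$-$\theta$-closure $e^*\text{-}cl_\theta(A)$ is the set of points $x\in X$ such that $e^*\text{-}cl(U)\cap A\neq\emptyset$ for every $e^*$-open set $U$ containing $x$. $A$ is $e^*$-$\theta$-closed if $A=e^*\text{-}cl_\theta(A)$; complements of $e^*$-$\theta$-closed sets are called $e^*$-$\theta$-open. $X$ is $e^*\theta$-normal if for any pair of disjoint closed sets $F_1$ and $F_2$ of $X$ there exist disjoint $e^*$-$\theta$-open sets $U_1$ and $U_2$ with $F_1\subseteq U_1$ and $F_2\subseteq U_2$. *)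

(* Defs.v *)
From mathcomp Require Import all_boot all_classical topology.

Set Implicit Arguments.
Unset Strict Implicit.
Unset Printing Implicit Defensive.

Local Open Scope classical_set_scope.

Definition delta_closure (X : topologicalType) (A : set X) : set X :=
  [set x | forall U : set X, open U -> U x -> (closure U)° `&` A !=set0].

Definition estar_open (X : topologicalType) (A : set X) : Prop :=
  A `<=` closure (delta_closure A)°.

Definition estar_closed (X : topologicalType) (A : set X) : Prop :=
  estar_open (~` A).

(* [smallest C A] is the intersection of all the sets M such that C M and
   A `<=` M; it does not presuppose that C is stable under intersection. *)
Definition estar_closure (X : topologicalType) (A : set X) : set X :=
  smallest (@estar_closed X) A.

Definition estar_theta_closure (X : topologicalType) (A : set X) : set X :=
  [set x | forall U : set X,
     estar_open U -> U x -> estar_closure U `&` A !=set0].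

Definition estar_theta_closed (X : topologicalType) (A : set X) : Prop :=
  A = estar_theta_closure A.

Definition estar_theta_open (X : topologicalType) (A : set X) : Prop :=
  estar_theta_closed (~` A).

Definition estar_theta_normal (X : topologicalType) : Prop :=
  forall F1 F2 : set X, closed F1 -> closed F2 -> F1 `&` F2 = set0 ->
    exists U1 U2 : set X,
      [/\ estar_theta_open U1, estar_theta_open U2, U1 `&` U2 = set0,
          F1 `<=` U1 & F2 `<=` U2].

(* Main.v *)
Require Import Defs.
From mathcomp Require Import all_boot all_classical topology.

Local Open Scope classical_set_scope.

(** The equivalences are complementation arguments once [estar_theta_closure]
    is known to be idempotent.  Idempotence holds because the e*-closure of an
    e*-open set is again e*-open: for e*-open [U] it equals [U] together with
    the open set [~` closure (delta_closure (~` U))°]. *)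

Lemma delta_closureS (X : topologicalType) (A B : set X) :
  A `<=` B -> delta_closure A `<=` delta_closure B.
Proof. by move=> AB x Ax U oU Ux; have [y [Uy /AB]] := Ax U oU Ux; exists y. Qed.

Lemma subset_delta_closure (X : topologicalType) (A : set X) :
  A `<=` delta_closure A.
Proof.
move=> x Ax U oU Ux; exists x; split=> //.
by apply: (interiorS (@subset_closure _ U)); exact: open_nbhs_nbhs.
Qed.

Lemma closure_int_delta_closureS (X : topologicalType) (A B : set X) :
  A `<=` B -> closure (delta_closure A)° `<=` closure (delta_closure B)°.
Proof. by move=> AB; apply/closureS/interiorS/delta_closureS. Qed.

Lemma open_estar_open (X : topologicalType) (A : set X) :
  open A -> estar_open A.
Proof.
move=> oA; apply: subset_trans (@subset_closure _ _).
by rewrite -open_subsetE//; exact: subset_delta_closure.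
Qed.

Lemma estar_openU (X : topologicalType) (A B : set X) :
  estar_open A -> estar_open B -> estar_open (A `|` B).
Proof.
by move=> oA oB x [/oA|/oB]; apply: closure_int_delta_closureS;
  [exact: subsetUl|exact: subsetUr].
Qed.

(* The set on the left is the e*-interior of [B]. *)
Lemma estar_open_setI_closure (X : topologicalType) (B : set X) :
  estar_open (B `&` closure (delta_closure B)°).
Proof.
move=> x [_]; apply: closureS; rewrite -open_subsetE; last exact: open_interior.
move=> {}x dBx O oO Ox.
(* Cutting the test neighbourhood [O] down to [O] meet the interior of the delta-closure makes one
   witness serve twice: the closure of the cut set lies in [closure O], as the delta-closure
   condition asks, and in the closure of that interior, which puts [y] in the second factor. *)
have oP : open (O `&` (delta_closure B)°) by apply: openI => //; exact: open_interior.
have [y [Py By]] := interior_subset dBx _ oP (conj Ox dBx).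
exists y; split; first by apply: interiorS Py; apply: closureS; exact: subIsetl.
by split=> //; apply: (closureS (@subIsetr _ O _)); exact: interior_subset.
Qed.

Lemma subset_estar_closure (X : topologicalType) (A : set X) :
  A `<=` estar_closure A.
Proof. exact: sub_gen_smallest. Qed.

Lemma estar_closure_sub (X : topologicalType) (A B : set X) :
  estar_closed B -> A `<=` B -> estar_closure A `<=` B.
Proof. exact: smallest_sub. Qed.

(** The complement of the right-hand side is the e*-interior of the complement of [A], so the
    right-hand side is an e*-closed superset of [A]. It is the least one because the operator
    defining e*-openness is monotone. *)
Lemma estar_closureE (X : topologicalType) (A : set X) :
  estar_closure A = A `|` ~` closure (delta_closure (~` A))°.
Proof.
apply/seteqP; split.
  apply: estar_closure_sub; last exact: subsetUl.
  by rewrite /estar_closed setCU setCK; exact: estar_open_setI_closure.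
move=> x [/subset_estar_closure//|nx] M [cM AM]; apply: contrapT => /cM Mx.
by apply: nx; apply: closure_int_delta_closureS Mx; exact: subsetC.
Qed.

Lemma estar_closed_closure (X : topologicalType) (A : set X) :
  estar_closed (estar_closure A).
Proof.
rewrite estar_closureE /estar_closed setCU setCK.
exact: estar_open_setI_closure.
Qed.

Lemma estar_open_closure (X : topologicalType) (A : set X) :
  estar_open A -> estar_open (estar_closure A).
Proof.
move=> oA; rewrite estar_closureE; apply: estar_openU => //.
by apply: open_estar_open; apply: closed_openC; exact: closed_closure.
Qed.

Lemma subset_estar_theta_closure (X : topologicalType) (A : set X) :
  A `<=` estar_theta_closure A.
Proof. by move=> x Ax U _ Ux; exists x; split=> //; exact: subset_estar_closure. Qed.

Lemma estar_theta_closureS (X : topologicalType) (A B : set X) :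
  A `<=` B -> estar_theta_closure A `<=` estar_theta_closure B.
Proof. by move=> AB x Ax U oU Ux; have [y [Uy /AB]] := Ax U oU Ux; exists y. Qed.

Lemma estar_theta_closed_closure (X : topologicalType) (A : set X) :
  estar_theta_closed (estar_theta_closure A).
Proof.
apply/seteqP; split; first exact: subset_estar_theta_closure.
move=> x clx U oU Ux; have [y [Uy Ay]] := clx U oU Ux.
(* The e*-closure of [U] is again e*-open and contains [y], so it is a legitimate test set for [Ay].
   The resulting double e*-closure collapses, [estar_closure U] being e*-closed. *)
have [z [Uz Az]] := Ay _ (estar_open_closure _ _ oU) Uy.
by exists z; split=> //; apply: estar_closure_sub Uz => //;
  exact: estar_closed_closure.
Qed.

Theorem theorem5 (X : topologicalType) :
  (estar_theta_normal X <->
   (forall U V : set X, open U -> open V -> U `|` V = setT ->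
      exists A B : set X,
        [/\ estar_theta_closed A, estar_theta_closed B,
            A `<=` U, B `<=` V & A `|` B = setT]))
  /\
  (estar_theta_normal X <->
   (forall F G : set X, closed F -> open G -> F `<=` G ->
      exists U : set X,
        [/\ estar_theta_open U, F `<=` U,
            U `<=` estar_theta_closure U & estar_theta_closure U `<=` G])).
Proof.
split; split.
- move=> nX U V oU oV UV.
  (* Complementation turns a cover into a disjoint pair and back. *)
  have [||| U1 [U2 [o1 o2 U12 UU1 VU2]]] := nX (~` U) (~` V).
  + exact: open_closedC.
  + exact: open_closedC.
  + by rewrite -setCU UV setCT.
  exists (~` U1), (~` U2); split=> //.
  + by rewrite -[X in _ `<=` X]setCK; exact: subsetC.
  + by rewrite -[X in _ `<=` X]setCK; exact: subsetC.
  + by rewrite -setCI U12 setC0.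
- move=> H F1 F2 c1 c2 F12.
  have [||| A [B [cA cB AF BF AB]]] := H (~` F1) (~` F2).
  + exact: closed_openC.
  + exact: closed_openC.
  + by rewrite -setCI F12 setC0.
  exists (~` A), (~` B); rewrite /estar_theta_open !setCK; split=> //.
  + by rewrite -setCU AB setCT.
  + by rewrite -[X in X `<=` _]setCK; exact: subsetC.
  + by rewrite -[X in X `<=` _]setCK; exact: subsetC.
- move=> nX F G cF oG FG.
  have [|| U1 [U2 [o1 o2 U12 FU1 GU2]]] := nX F (~` G) cF.
  + exact: open_closedC.
  + by apply/disjoints_subset; rewrite setCK.
  exists U1; split=> //; first exact: subset_estar_theta_closure.
  (* The complement of [U2] is interposed: it contains [U1] by disjointness and equals its own
     e*-theta-closure by [o2], hence contains that of [U1]. *)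
  apply: subset_trans (_ : ~` U2 `<=` G).
    by rewrite [X in _ `<=` X]o2; apply: estar_theta_closureS; apply/disjoints_subset.
  by rewrite -[X in _ `<=` X]setCK; exact: subsetC.
- move=> H F1 F2 c1 c2 /disjoints_subset F12.
  have [U [oU FU UcU UF]] := H F1 (~` F2) c1 (closed_openC c2) F12.
  (* Idempotence of the e*-theta-closure is what makes the second witness e*-theta-open. *)
  exists U, (~` estar_theta_closure U); split=> //.
  + by rewrite /estar_theta_open setCK; exact: estar_theta_closed_closure.
  + by apply/disjoints_subset; rewrite setCK.
  + by rewrite -[X in X `<=` _]setCK; exact: subsetC.
Qed.
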